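(* If $B$ is a real Banach space with roundness $r(B)$, then $C(B)\leq 2^{1/r(B)}$.
   Context: For a metric space $(X,d)$ and $\mu \geq 0$, say that $(X,d)$ satisfies the $(\mu,0)$-four-point inequality if for all $x,y,z,w\in X$, $d(x,y)+d(z,w)\le \mu\max\{d(x,z)+d(y,w),\ d(x,w)+d(y,z)\}$. The quadrilateral constant of $(X,d)$ is $C_0(X,d)=\inf\{\mu\geq 0 \mid (X,d)\text{ satisfies the }(\mu,0)\text{-four-point inequality}\}$. For a real Banach space $B$ with norm $\|\cdot\|$, $C(B)$ denotes $C_0(B,d)$ where $d(u,v)=\|u-v\|$. For $p\geq 1$, a metric space $(X,d)$ is $p$-round if for all $x,y,z,w\in X$, $d(x,y)^p+d(z,w)^p\leq d(x,z)^p+d(y,w)^p+d(x,w)^p+d(y,z)^p$. The roundness of $(X,d)$ is $r(X,d)=\sup\{p \geq 1\mid (X,d)\text{ is }p\text{-round}\}$, and $r(B)$ is the roundness of $B$ with its norm metric. By convention $1/\infty=0$. *)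

(* Defs.v *)
From HB Require Import structures.
From mathcomp Require Import all_boot all_order all_algebra.
From mathcomp Require Import all_classical all_reals all_analysis.
Set Implicit Arguments.
Unset Strict Implicit.
Unset Printing Implicit Defensive.
Import Order.TTheory GRing.Theory Num.Theory.
Import numFieldNormedType.Exports.
Local Open Scope classical_set_scope.
Local Open Scope ring_scope.

Definition four_point_ineq (R : realType) (X : metricType R) (mu : R) : Prop :=
  forall x y z w : X,
    mdist x y + mdist z w
      <= mu * Num.max (mdist x z + mdist y w) (mdist x w + mdist y z).

(* This set of reals contains 2 (by the triangle inequality) and is bounded
   below by 0, so [inf] is a genuine infimum, never its default value. *)
Definition quadrilateral_constant (R : realType) (X : metricType R) : R :=
  inf [set mu : R | 0 <= mu /\ four_point_ineq X mu].

Definition p_round (R : realType) (X : metricType R) (p : R) : Prop :=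
  forall x y z w : X,
    mdist x y `^ p + mdist z w `^ p
      <= mdist x z `^ p + mdist y w `^ p + mdist x w `^ p + mdist y z `^ p.

(* Extended-real valued since the supremum can be infinite: a one-point space
   is p-round for every p >= 1. *)
Definition roundness (R : realType) (X : metricType R) : \bar R :=
  ereal_sup [set p%:E | p in [set p : R | 1 <= p /\ p_round X p]].

(* MathComp-Analysis does not equip normed modules with a [metricType]
   structure; [norm_metric B] is B with the distance `|u - v|. *)
Definition norm_metric (R : realType) (B : normedModType R) : Type := B.

Section norm_metric.
Context {R : realType} {B : normedModType R}.
Implicit Types u v : B.

HB.instance Definition _ := PseudoMetric.copy (norm_metric B) B.

Let dist (u v : norm_metric B) : R := `|(u : B) - (v : B)|.

Let dist_ge0 u v : 0 <= dist u v. Proof. exact: normr_ge0. Qed.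

Let dist_positivity (u v : norm_metric B) : dist u v = 0 -> u = v.
Proof. by move/normr0_eq0/eqP; rewrite subr_eq0 => /eqP. Qed.

Let ballE_dist (u : norm_metric B) r : ball u r = [set v | dist u v < r].
Proof. by rewrite -[LHS]/(@ball R B u r) -ball_normE. Qed.

HB.instance Definition _ := @PseudoMetric_isMetric.Build R (norm_metric B)
  dist dist_ge0 dist_positivity ballE_dist.

End norm_metric.

Lemma norm_metricE (R : realType) (B : normedModType R)
  (u v : norm_metric B) : mdist u v = `|(u : B) - (v : B)|.
Proof. by []. Qed.

(* Main.v *)
Require Import Defs.
From HB Require Import structures.
From mathcomp Require Import all_boot all_order all_algebra.
From mathcomp Require Import all_classical all_reals all_analysis.
From mathcomp Require Import lra.
Import Order.TTheory GRing.Theory Num.Theory.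
Import numFieldNormedType.Exports.
Local Open Scope classical_set_scope.
Local Open Scope ring_scope.

(** Two diagonals of a quadrilateral in a normed space can be moved, keeping
    their vectors [u] and [v], so that they become the diagonals of a
    parallelogram. The sides of that parallelogram are [(u + v) / 2] and
    [(u - v) / 2], and each of the vectors [u + v] and [u - v] is a sum of two
    opposite sides of the original quadrilateral; hence, if [M] bounds both
    sums of lengths of opposite sides, the parallelogram has sides of length at
    most [M / 2]. On a parallelogram, p-roundness says that the [p]-th powers
    of the diagonals sum to at most twice the sum of the [p]-th powers of two
    adjacent sides, and convexity of [t |-> t `^ p] turns this into the bound
    [2 `^ p^-1 * M] on the sum of the diagonals
    ([parallelogram_diagonals_le], [p_round_four_point_ineq]).

    So the quadrilateral constant [C] satisfies [C <= 2 `^ p^-1] for every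
    exponent [p] of roundness. Passing to the supremum of these [p], which need
    not be an exponent itself and may be infinite, is done on the logarithmic
    side ([le_powR_inve_ereal_sup]): the bounds say [p * log_2 C <= 1]. *)

Lemma midpoint_powR_le (R : realType) (p s t : R) :
  1 <= p -> 0 <= s -> 0 <= t ->
  (2^-1 * (s + t)) `^ p <= 2^-1 * (s `^ p + t `^ p).
Proof.
move=> p1 s0 t0; rewrite !mulrDr.
(* A convex combination has weights [h] and [1 - h]. *)
rewrite {2 4}(_ : 2^-1 = 1 - 2^-1 :> R); last by lra.
by apply: (convex_powR p1 (Itv01 _ _)) => //=;
  rewrite ?inE/= ?in_itv/= ?andbT// ?invr_ge0// invf_le1 ?ler1n.
Qed.

(** Roundness applied to the parallelogram with vertices [0], [a], [a + b],
    [b], whose diagonals are [a + b] and [a - b]: a one-sided form of the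
    parallelogram law. *)
Lemma p_round_parallelogram (R : realType) (B : normedModType R) (p : R)
    (a b : B) : p_round (norm_metric B) p ->
  `|a + b| `^ p + `|a - b| `^ p <= 2 * (`|a| `^ p + `|b| `^ p).
Proof.
move=> /(_ (a + b) 0 a b); rewrite !norm_metricE !subr0 !sub0r !normrN.
rewrite addrK (addrC a b) addrK => /le_trans; apply.
lra.
Qed.

(** The factor [2 `^ p^-1] is the [p]-th root of [m `^ p + m `^ p] over [m]: by
    convexity, the mean of the diagonals has [p]-th power at most
    [`|a| `^ p + `|b| `^ p]. *)
Lemma parallelogram_diagonals_le (R : realType) (B : normedModType R)
    (p m : R) (a b : B) : 1 <= p -> p_round (norm_metric B) p ->
  `|a| <= m -> `|b| <= m -> `|a + b| + `|a - b| <= 2 `^ p^-1 * (2 * m).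
Proof.
move=> p1 Bp am bm.
have p0 : 0 < p by exact: lt_le_trans p1.
have m0 : 0 <= m by exact: le_trans am.
suff : 2^-1 * (`|a + b| + `|a - b|) <= 2 `^ p^-1 * m by lra.
rewrite leNgt; apply/negP => /(gt0_ltr_powR p0).
rewrite !nnegrE !mulr_ge0 ?addr_ge0 ?powR_ge0 ?invr_ge0// => /(_ isT isT).
apply/negP; rewrite -leNgt powRM ?powR_ge0// -powRrM mulVf ?gt_eqF// powRr1//.
apply: le_trans (midpoint_powR_le _ _ _ _ p1 _ _) _ => //.
have := p_round_parallelogram _ _ _ a b Bp.
have : `|a| `^ p <= m `^ p by apply: ge0_ler_powR; rewrite ?nnegrE// ltW.
have : `|b| `^ p <= m `^ p by apply: ge0_ler_powR; rewrite ?nnegrE// ltW.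
lra.
Qed.

(** Linear structure enters here: replacing the quadrilateral by the
    parallelogram with the same diagonal vectors averages opposite sides, so
    sums of opposite sides, and not only single sides, control the diagonals. *)
Lemma p_round_four_point_ineq (R : realType) (B : normedModType R) (p : R) :
  1 <= p -> p_round (norm_metric B) p ->
  four_point_ineq (norm_metric B) (2 `^ p^-1).
Proof.
move=> p1 Bp x y z w; rewrite !norm_metricE.
set M := Num.max _ _.
pose u : B := x - y; pose v : B := z - w.
have uDv : `|u + v| <= M.
  rewrite le_max; apply/orP; right.
  suff -> : u + v = (x - w) - (y - z) by exact: ler_normB.
  by rewrite opprB addrACA [in RHS]addrACA; congr (_ + _); exact: addrC.
have uBv : `|u - v| <= M.
  rewrite le_max; apply/orP; left.
  suff -> : u - v = (x - z) - (y - w) by exact: ler_normB.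
  by rewrite !opprB addrACA [in RHS]addrACA; congr (_ + _); exact: addrC.
have half_le (a : B) : `|a| <= M -> `|2^-1 *: a| <= 2^-1 * M.
  by move=> aM; rewrite normrZ ger0_norm ?invr_ge0// ler_pM2l ?invr_gt0.
have half_double (a : B) : 2^-1 *: (a + a) = a.
  by rewrite -mulr2n -[a *+ 2]scaler_nat scalerA mulVf ?scale1r.
have := parallelogram_diagonals_le _ _ _ _ _ _ p1 Bp
  (half_le _ uDv) (half_le _ uBv).
rewrite -scalerDr -scalerBr [u + v + _]addrACA subrr addr0.
by rewrite opprB [u + v]addrC [v + u + _]addrACA subrr addr0 !half_double
  mulVKf.
Qed.

(** Averaging, for each diagonal, the two triangle inequalities through the two
    other vertices. This makes the supremum defining the roundness one over a
    nonempty set. *)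
Lemma p_round1 (R : realType) (X : metricType R) : p_round X 1.
Proof.
move=> x y z w; rewrite !powRr1 ?mdist_ge0//.
have := metric_triangle x z y; have := metric_triangle x w y.
have := metric_triangle z x w; have := metric_triangle z y w.
rewrite (metric_sym z x) (metric_sym z y) (metric_sym w y); lra.
Qed.

(** With [L := ln c / ln 2] the hypothesis reads [p * L <= 1] for every [p] in
    [A]: if [L <= 0] any nonnegative exponent will do, and if [0 < L] then
    [L^-1] bounds [A], so the supremum is finite and at most [L^-1]. No limit
    of exponentials is taken. *)
Lemma le_powR_inve_ereal_sup (R : realType) (A : set R) (c : R) :
  A !=set0 -> (forall p, A p -> 0 < p /\ c <= 2 `^ p^-1) ->
  c <= 2 `^ fine ((ereal_sup [set p%:E | p in A])^-1)%E.
Proof.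
move=> [q Aq] Ac; set r := ereal_sup _.
have q0 : 0 < q by case: (Ac q Aq).
have qr : (q%:E <= r)%E by apply: ereal_sup_ubound; exists q.
have [c0|c0] := leP c 0; first by apply: le_trans c0 (powR_ge0 _ _).
have ln2_gt0 : 0 < ln (2 : R) by rewrite ln_gt0// ltr1n.
pose L := ln c / ln 2.
have cE : c = 2 `^ L by rewrite /powR gt_eqF// /L divfK ?gt_eqF// lnK.
have LA p : A p -> L <= p^-1.
  by move=> /Ac[p0 cp]; rewrite /L ler_pdivrMr// -ln_powR ler_ln// posrE.
rewrite [leLHS]cE ler_powR ?ler1n//.
have [L0|L0] := leP L 0.
  rewrite (le_trans L0)// fine_ge0// inve_ge0.
  by rewrite (le_trans _ qr)// lee_fin ltW.
have : (r <= L^-1%:E)%E.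
  apply: ge_ereal_sup => _ [p Ap <-]; rewrite lee_fin.
  have [p0 _] := Ac p Ap.
  by rewrite -[p]invrK lef_pV2 ?posrE ?invr_gt0// LA.
case: r qr => [r| |] //; rewrite !lee_fin => qr rL.
have r0 : 0 < r by exact: lt_le_trans qr.
by rewrite inver gt_eqF//= -[L]invrK lef_pV2 ?posrE ?invr_gt0.
Qed.

(* [((+oo)^-1)%E = 0], which is the convention 1/oo = 0; the roundness is always
   at least 1, so its inverse is finite and [fine] loses nothing. *)
Theorem theorem5p11 (R : realType) (B : completeNormedModType R) :
  quadrilateral_constant (norm_metric B)
    <= 2 `^ fine ((roundness (norm_metric B))^-1)%E.
Proof.
apply: le_powR_inve_ereal_sup.
  by exists 1; split => //; exact: p_round1.
move=> p [p1 Bp]; split; first exact: lt_le_trans p1.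
apply: ge_inf; first by exists 0 => mu [].
by split; [exact: powR_ge0|exact: p_round_four_point_ineq].
Qed.
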